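(* Let $\mathbb F\in\{\mathbb R,\mathbb C,\mathbb H\}$, $m\ge1$, $n=m+1$ and $s_m=\frac{2(m+1)}{m}$. The standard embedding $$\Phi_{\mathbb F}:(\mathbb FP^m,s_mg_0)\to\mathbb S^{N},\qquad \Phi_{\mathbb F}([x])=\sqrt{\tfrac{m+1}{m}}\left(xx^*-\tfrac1nI_n\right)\quad(|x|=1),$$ is minimal, and its second fundamental form $B$ is parallel. Moreover, if $V\in T_{[x]}\mathbb FP^m$ is a unit vector with respect to $g_\Phi=s_mg_0$ and $u\in x^\perp$ is the corresponding $g_0$-unit vector (so that $V=\frac{1}{\sqrt{s_m}}u$), then $$B(V,V)=\sqrt{\frac{m}{m+1}}\left(P_u-\frac1m(I_n-P_x)\right).$$ In particular, $|B(V,V)|^2=\dfrac{m-1}{m+1}$.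
   Context: For $\mathbb F\in\{\mathbb R,\mathbb C,\mathbb H\}$ let $d=\dim_{\mathbb R}\mathbb F$. $\mathbb F^{n}$ is a right $\mathbb F$-vector space with $\langle x,y\rangle_{\mathbb F}=x^*y$ and real inner product $\langle x,y\rangle_{\mathbb R}=\operatorname{Re}(x^*y)$. $\mathbb FP^m=\mathbb S^{dn-1}/\mathbb S^{d-1}$ is the quotient of the unit sphere by unit scalars acting on the right; $g_0$ is the quotient (Riemannian submersion) metric, so that $T_{[x]}\mathbb FP^m\simeq x^\perp=\{u\in\mathbb F^n:x^*u=0\}$ isometrically for $\langle\cdot,\cdot\rangle_{\mathbb R}$. For a unit vector $x\in\mathbb F^n$, $P_x=xx^*$ is the orthogonal projection onto the line $x\mathbb F$. $\mathcal H_n^0(\mathbb F)$ is the real vector space of trace-free Hermitian $n\times n$ matrices over $\mathbb F$, with inner product $\langle A,B\rangle=\operatorname{Re}\operatorname{tr}(AB)$, and $\mathbb S^N$ is its unit sphere, $N=n+d\frac{n(n-1)}2-2$. Under the identification above, $d\Phi_{\mathbb F}(u)=\sqrt{\frac{m+1}{m}}(xu^*+ux^* )$, and $\Phi_{\mathbb F}$ is an isometric embedding of $(\mathbb FP^m,s_mg_0)$ into $\mathbb S^N$; $B$ is its second fundamental form in $\mathbb S^N$, with values regarded as elements of $\mathcal H_n^0(\mathbb F)$. *)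

(* Defs.v *)
From HB Require Import structures.
From mathcomp Require Import all_boot all_order all_algebra.
From mathcomp Require Import ring.
From mathcomp Require Import complex.
From mathcomp Require Import all_classical all_reals all_analysis.
Import Order.TTheory GRing.Theory Num.Theory.
Import numFieldNormedType.Exports.

Set Implicit Arguments.
Unset Strict Implicit.
Unset Printing Implicit Defensive.

Local Open Scope classical_set_scope.
Local Open Scope ring_scope.

(* [Quat a b c d] is a + b i + c j + d k. *)
Record quat (R : Type) := Quat { q0 : R; q1 : R; q2 : R; q3 : R }.

Definition quat_to_prod (R : Type) (x : quat R) : R * R * (R * R) :=
  (q0 x, q1 x, (q2 x, q3 x)).
Definition quat_of_prod (R : Type) (p : R * R * (R * R)) : quat R :=
  Quat p.1.1 p.1.2 p.2.1 p.2.2.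
Lemma quat_to_prodK (R : Type) : cancel (@quat_to_prod R) (@quat_of_prod R).
Proof. by case. Qed.

HB.instance Definition _ (R : eqType) := Equality.copy (quat R)
  (can_type (@quat_to_prodK R)).
HB.instance Definition _ (R : choiceType) := Choice.copy (quat R)
  (can_type (@quat_to_prodK R)).

Section QuaternionAlgebra.
Variable R : comNzRingType.
Implicit Types x y z : quat R.

Definition quat_add x y :=
  Quat (q0 x + q0 y) (q1 x + q1 y) (q2 x + q2 y) (q3 x + q3 y).
Definition quat_opp x := Quat (- q0 x) (- q1 x) (- q2 x) (- q3 x).
Definition quat_mul x y := Quat
  (q0 x * q0 y - q1 x * q1 y - q2 x * q2 y - q3 x * q3 y)
  (q0 x * q1 y + q1 x * q0 y + q2 x * q3 y - q3 x * q2 y)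
  (q0 x * q2 y - q1 x * q3 y + q2 x * q0 y + q3 x * q1 y)
  (q0 x * q3 y + q1 x * q2 y - q2 x * q1 y + q3 x * q0 y).
Definition quat_scale (a : R) x := Quat (a * q0 x) (a * q1 x) (a * q2 x) (a * q3 x).
Definition quat_conj x := Quat (q0 x) (- q1 x) (- q2 x) (- q3 x).

Lemma quat_addA : associative quat_add.
Proof. by move=> x y z; congr Quat; rewrite /= addrA. Qed.
Lemma quat_addC : commutative quat_add.
Proof. by move=> x y; congr Quat; rewrite /= addrC. Qed.
Lemma quat_add0 : left_id (Quat 0 0 0 0) quat_add.
Proof. by case=> *; congr Quat; rewrite /= add0r. Qed.
Lemma quat_addN : left_inverse (Quat 0 0 0 0) quat_opp quat_add.
Proof. by move=> x; congr Quat; rewrite /= addNr. Qed.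
HB.instance Definition _ :=
  GRing.isZmodule.Build (quat R) quat_addA quat_addC quat_add0 quat_addN.

Lemma quat_mulA : associative quat_mul.
Proof. by move=> x y z; congr Quat => /=; ring. Qed.
Lemma quat_mul1 : left_id (Quat 1 0 0 0) quat_mul.
Proof. by case=> *; congr Quat => /=; ring. Qed.
Lemma quat_mulr1 : right_id (Quat 1 0 0 0) quat_mul.
Proof. by case=> *; congr Quat => /=; ring. Qed.
Lemma quat_mulDl : left_distributive quat_mul quat_add.
Proof. by move=> x y z; congr Quat => /=; ring. Qed.
Lemma quat_mulDr : right_distributive quat_mul quat_add.
Proof. by move=> x y z; congr Quat => /=; ring. Qed.
Lemma quat_oneN0 : Quat 1 0 0 0 != 0 :> quat R.
Proof. by apply/eqP => -[] /eqP; rewrite oner_eq0. Qed.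
HB.instance Definition _ := GRing.Zmodule_isNzRing.Build (quat R)
  quat_mulA quat_mul1 quat_mulr1 quat_mulDl quat_mulDr quat_oneN0.

Lemma quat_scaleA a b x : quat_scale a (quat_scale b x) = quat_scale (a * b) x.
Proof. by congr Quat => /=; rewrite mulrA. Qed.
Lemma quat_scale1 : left_id 1 quat_scale.
Proof. by case=> *; congr Quat => /=; rewrite mul1r. Qed.
Lemma quat_scaleDr : right_distributive quat_scale +%R.
Proof. by move=> a x y; congr Quat => /=; rewrite mulrDr. Qed.
Lemma quat_scaleDl x : {morph quat_scale^~ x : a b / a + b}.
Proof. by move=> a b; congr Quat => /=; rewrite mulrDl. Qed.
HB.instance Definition _ := GRing.Zmodule_isLmodule.Build R (quat R)
  quat_scaleA quat_scale1 quat_scaleDr quat_scaleDl.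

Lemma quat_scaleAl (a : R) x y : a *: (x * y) = (a *: x) * y.
Proof. by congr Quat => /=; ring. Qed.
HB.instance Definition _ :=
  GRing.Lmodule_isLalgebra.Build R (quat R) quat_scaleAl.

Lemma quat_scaleAr (a : R) x y : a *: (x * y) = x * (a *: y).
Proof. by congr Quat => /=; ring. Qed.
HB.instance Definition _ :=
  GRing.Lalgebra_isAlgebra.Build R (quat R) quat_scaleAr.
End QuaternionAlgebra.

Lemma Rcomplex_scaleAr (R : realType) (a : R) (x y : Rcomplex R) :
  a *: (x * y) = x * (a *: y).
Proof. by rewrite mulrC scalerAl mulrC. Qed.
HB.instance Definition _ (R : realType) :=
  GRing.Lalgebra_isAlgebra.Build R (Rcomplex R) (@Rcomplex_scaleAr R).

Inductive scalar_kind := Reals | Complexes | Quaternions.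

Definition scalars (R : realType) (k : scalar_kind) : algType R :=
  match k with
  | Reals => R^o
  | Complexes => Rcomplex R
  | Quaternions => quat R
  end.

Section ScalarStructure.
Variables (R : realType) (k : scalar_kind).

Definition conjF : scalars R k -> scalars R k :=
  match k return scalars R k -> scalars R k with
  | Reals => fun x => x
  | Complexes => fun x => conjc x
  | Quaternions => fun x => quat_conj x
  end.

Definition reF : scalars R k -> R :=
  match k return scalars R k -> R with
  | Reals => fun x => x
  | Complexes => fun x => complex.Re x
  | Quaternions => fun x => q0 x
  end.

(* The standard real basis 1 (, i (, j, k)); it is orthonormal for
   (x, y) |-> Re (x^* y). *)
Definition basisF : seq (scalars R k) :=
  match k return seq (scalars R k) with
  | Reals => [:: 1]
  | Complexes => [:: Complex 1 0; Complex 0 1]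
  | Quaternions => [:: Quat 1 0 0 0; Quat 0 1 0 0; Quat 0 0 1 0; Quat 0 0 0 1]
  end.

Definition unit_scalar (q : scalars R k) : Prop := reF (conjF q * q) = 1.
End ScalarStructure.

Lemma unit_scalar1 (R : realType) (k : scalar_kind) :
  unit_scalar (1 : scalars R k).
Proof. by case: k; rewrite /unit_scalar /= ?mulr1 //; ring. Qed.

Lemma unit_scalarV (R : realType) (k : scalar_kind) (q : scalars R k) :
  unit_scalar q -> q * conjF q = 1 /\ unit_scalar (conjF q).
Proof.
case: k q => [q|[a b]|[a b c d]]; rewrite /unit_scalar /=.
- by [].
- move=> H; split; last by rewrite -[RHS]H; ring.
  change (Complex (a * a - b * - b) (a * - b + b * a) = Complex 1 0).
  by congr (@Complex R); [rewrite -[RHS]H|]; rewrite /=; ring.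
- move=> H; split; last by rewrite -[RHS]H; ring.
  by congr (@Quat R); [rewrite -[RHS]H| | |]; rewrite /=; ring.
Qed.

Lemma unit_scalarM (R : realType) (k : scalar_kind) (p q : scalars R k) :
  unit_scalar p -> unit_scalar q -> unit_scalar (p * q).
Proof.
rewrite /unit_scalar; case: k p q => [p q|[a b] [a' b']|[a b c d] [a' b' c' d']] /= H H';
  move: (congr2 *%R H H'); rewrite mulr1 => E; rewrite -[RHS]E; clear; ring.
Qed.

Lemma conjF0 (R : realType) (k : scalar_kind) : conjF (0 : scalars R k) = 0.
Proof.
by case: k => //; [congr (@Complex R)|congr (@Quat R)]; exact: oppr0.
Qed.

Lemma conjFD (R : realType) (k : scalar_kind) :
  {morph @conjF R k : x y / x + y}.
Proof.
case: k => [//|[a b] [c d]|x y]; first by congr (@Complex R); exact: opprD.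
by congr (@Quat R); exact: opprD.
Qed.

Lemma conjFM (R : realType) (k : scalar_kind) (x y : scalars R k) :
  conjF (x * y) = conjF y * conjF x.
Proof.
case: k x y => [x y|[a b] [c d]|[a b c d] [a' b' c' d']].
- exact: mulrC.
- change (Complex (a * c - b * d) (- (a * d + b * c)) =
          Complex (c * a - (- d) * (- b)) (c * - b + - d * a)).
  by congr (@Complex R); ring.
- by congr (@Quat R); rewrite /=; ring.
Qed.

Section Matrices.
Variables (R : realType) (k : scalar_kind).
Local Notation F := (scalars R k).

Definition adjmx p q (A : 'M[F]_(p, q)) : 'M[F]_(q, p) := map_mx (@conjF R k) A^T.

Definition innerR n (x y : 'cV[F]_n) : R := reF (\tr (adjmx x *m y)).

Definition unit_vec n (x : 'cV[F]_n) : Prop := innerR x x = 1.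

Definition line_proj n (x : 'cV[F]_n) : 'M[F]_n := x *m adjmx x.

(* As a real vector space, [herm0 n] has dimension N + 1 with
   N = n + d n (n - 1) / 2 - 2, so that [sphereH n] below is S^N. *)
Definition herm0 n : set 'M[F]_n := [set A | adjmx A = A /\ \tr A = 0].
Definition ipH n (A B : 'M[F]_n) : R := reF (\tr (A *m B)).
Definition sphereH n : set 'M[F]_n := [set A | herm0 A /\ ipH A A = 1].

(* Curves of matrices are differentiated entrywise, in real coordinates. *)
Definition coord_fun p q (c : R -> 'M[F]_(p, q)) (i : 'I_p) (j : 'I_q) (e : F) :
  R -> R := fun t => reF (conjF e * c t i j).

Definition smooth_curve p q (c : R -> 'M[F]_(p, q)) : Prop :=
  forall i j e, e \in basisF R k ->
  forall (r : nat) (t : R), derivable (derive1n r (coord_fun c i j e)) t 1.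

Definition velocity p q (c : R -> 'M[F]_(p, q)) (t : R) : 'M[F]_(p, q) :=
  \matrix_(i, j) \sum_(e <- basisF R k) derive1 (coord_fun c i j e) t *: e.

Lemma adjmxM p q r (A : 'M[F]_(p, q)) (B : 'M[F]_(q, r)) :
  adjmx (A *m B) = adjmx B *m adjmx A.
Proof.
apply/matrixP => i j; rewrite !mxE (big_morph _ (@conjFD R k) (@conjF0 R k)).
by apply: eq_bigr => l _; rewrite !mxE conjFM.
Qed.

Lemma adjmx_scalar (q : F) : adjmx (q%:M : 'M[F]_1) = (conjF q)%:M.
Proof. by apply/matrixP => i j; rewrite !mxE !ord1 eqxx. Qed.
End Matrices.

Section ProjectiveSpace.
Variables (R : realType) (k : scalar_kind) (m : nat).
Local Notation F := (scalars R k).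
Local Notation n := m.+1.

Definition usphere := {x : 'cV[F]_n | `[< unit_vec x >]}.

Definition phase_eq (x y : usphere) : bool :=
  `[< exists q : F, unit_scalar q /\ val y = val x *m q%:M >].

Lemma phase_eq_refl : reflexive phase_eq.
Proof.
by move=> x; apply/asboolP; exists 1; split; [exact: unit_scalar1|rewrite mulmx1].
Qed.

Lemma phase_eq_sym : symmetric phase_eq.
Proof.
move=> x y; apply/idP/idP => /asboolP[q [uq exy]]; apply/asboolP;
  have [qV uV] := unit_scalarV uq; exists (conjF q); split=> //;
  by rewrite exy -mulmxA -scalar_mxM qV mulmx1.
Qed.

Lemma phase_eq_trans : transitive phase_eq.
Proof.
move=> y x z /asboolP[p [up exy]] /asboolP[q [uq eyz]]; apply/asboolP.
exists (p * q); split; first exact: unit_scalarM.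
by rewrite eyz exy -mulmxA -scalar_mxM.
Qed.

Definition phase_equiv := EquivRel phase_eq phase_eq_refl phase_eq_sym phase_eq_trans.
(* The unit scalars act on the right, so this is FP^m = S^(dn-1) / S^(d-1). *)
Definition projective_space := {eq_quot phase_equiv}%qT.

Definition class_of (x : usphere) : projective_space := \pi_(projective_space)%qT x.

(* T_[x] FP^m is identified with the horizontal space x^perp by d(pi)_x; at
   another representative x q of the same point, u corresponds to u q. *)
Definition tangent (x : usphere) : set 'cV[F]_n :=
  [set u | adjmx (val x) *m u = 0].

(* Smooth curves of FP^m are the projections of smooth curves of the sphere. *)
Definition sphere_curve (c : R -> usphere) : Prop :=
  smooth_curve (fun t => val (c t)).

(* Smooth vector fields along the projection of [c], lifted horizontally. *)
Definition field_along (c : R -> usphere) (y : R -> 'cV[F]_n) : Prop :=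
  smooth_curve y /\ forall t, tangent (c t) (y t).

Definition s_m : R := 2 * m.+1%:R / m%:R.
Definition g0 (u v : 'cV[F]_n) : R := innerR u v.
Definition gPhi (u v : 'cV[F]_n) : R := s_m * g0 u v.

End ProjectiveSpace.

(* In this section [f] is to be thought of as an isometric immersion for a metric [g], given on
   horizontal vectors.  Tangent vectors at a point are represented in the horizontal
   space at a chosen representative [x].  The values [xget 0 _] are the unique
   elements of the corresponding sets when [f] is an isometric immersion. *)

Section Immersions.
Variables (R : realType) (k : scalar_kind) (m : nat).
Local Notation F := (scalars R k).
Local Notation n := m.+1.
Variables (f : projective_space R k m -> 'M[F]_n) (g : 'cV[F]_n -> 'cV[F]_n -> R).
Implicit Types (x : usphere R k m) (c : R -> usphere R k m).
Implicit Types (u v w : 'cV[F]_n) (A : 'M[F]_n).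

Definition differential x u : 'M[F]_n :=
  xget 0 [set A | exists c, [/\ sphere_curve c, c 0 = x,
    velocity (fun t => val (c t)) 0 = u &
    A = velocity (fun t => f (class_of (c t))) 0]].

(* FP^m is compact, so that an injective immersion is an embedding; smoothness
   is tested along smooth curves. *)
Definition isometric_embedding : Prop :=
  [/\ forall p, sphereH (f p),
      injective f,
      forall c, sphere_curve c -> smooth_curve (fun t => f (class_of (c t)))
    & forall x u v, tangent x u -> tangent x v ->
        ipH (differential x u) (differential x v) = g u v].

(* Normal in S^N, hence also orthogonal to the position vector f [x]. *)
Definition normal_space x : set 'M[F]_n :=
  [set A | [/\ herm0 A, ipH (f (class_of x)) A = 0 &
    forall u, tangent x u -> ipH (differential x u) A = 0]].

Definition normal_part x A : 'M[F]_n :=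
  xget 0 [set B | normal_space x B /\
    forall C, normal_space x C -> ipH C (A - B) = 0].

(* The vector of T_[x] FP^m whose image is the tangential part of A. *)
Definition tangential_part x A : 'cV[F]_n :=
  xget 0 [set z | tangent x z /\
    forall u, tangent x u -> ipH (differential x u) (A - differential x z) = 0].

(* The derivative of d f(y) along c in the Euclidean space of trace-free
   Hermitian matrices; the Gauss formula splits it into d f(nabla_t y), the normal
   part B(c', y), and a component along the position vector. *)
Definition ambient_derivative c (y : R -> 'cV[F]_n) (t : R) : 'M[F]_n :=
  velocity (fun s => differential (c s) (y s)) t.

Definition covariant_derivative c (y : R -> 'cV[F]_n) (t : R) : 'cV[F]_n :=
  tangential_part (c t) (ambient_derivative c y t).

Definition second_fundamental_form x v w : 'M[F]_n :=
  xget 0 [set A | exists c y, [/\ sphere_curve c /\ field_along c y,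
    c 0 = x, velocity (fun t => val (c t)) 0 = v, y 0 = w &
    A = normal_part x (ambient_derivative c y 0)]].

Definition orthonormal_basis x r (e : 'I_r -> 'cV[F]_n) : Prop :=
  [/\ forall i, tangent x (e i),
      forall i j, g (e i) (e j) = (i == j)%:R
    & forall u, tangent x u ->
        exists a : 'I_r -> R, u = \sum_i (a i)%:A *: e i].

Definition minimal_immersion : Prop :=
  forall x r (e : 'I_r -> 'cV[F]_n), orthonormal_basis x e ->
    \sum_i second_fundamental_form x (e i) (e i) = 0.

(* nabla^perp (B(y, z)) = B(nabla y, z) + B(y, nabla z) along every curve. *)
Definition parallel_second_fundamental_form : Prop :=
  forall c y z, sphere_curve c -> field_along c y -> field_along c z ->
    let Byz t := second_fundamental_form (c t) (y t) (z t) in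
    smooth_curve Byz /\
    forall t, normal_part (c t) (velocity Byz t) =
      second_fundamental_form (c t) (covariant_derivative c y t) (z t) +
      second_fundamental_form (c t) (y t) (covariant_derivative c z t).

End Immersions.

Section StandardEmbedding.
Variables (R : realType) (k : scalar_kind) (m : nat).
Local Notation F := (scalars R k).
Local Notation n := m.+1.

Definition Phi_unit (x : 'cV[F]_n) : 'M[F]_n :=
  (Num.sqrt (n%:R / m%:R : R))%:A *: (x *m adjmx x - (n%:R^-1 : R)%:A%:M).

Definition Phi (p : projective_space R k m) : 'M[F]_n :=
  Phi_unit (val (repr p)).

Lemma Phi_class_of (x : usphere R k m) : Phi (class_of x) = Phi_unit (val x).
Proof.
rewrite /Phi /class_of; case: piP => y /eqmodP /asboolP [q [uq ->]].
have [qV _] := unit_scalarV uq.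
rewrite /Phi_unit adjmxM adjmx_scalar mulmxA -[X in X *m adjmx _]mulmxA.
by rewrite -scalar_mxM qV mulmx1.
Qed.

End StandardEmbedding.

(* Main.v *)
(* Put s = sqrt ((m + 1) / m), Q = I - x x^* and symp a b = a b^* + b a^*.  Along a
   curve of the sphere, dPhi (u) = s symp u x, and the normal space at [x] consists
   of the trace-free Hermitian C with C x = 0; hence the normal part of a Hermitian
   D is N D = Q D Q - (Re tr (Q D Q) / m) Q.  Differentiating s symp y c along a
   horizontal field y gives B (v, w) = s N (symp v w), because N kills symp x b.
   Minimality: for a real orthonormal basis e_i of x^perp, the sum of the e_i e_i^*
   is a real multiple of Q, and N Q = 0.  Parallelism: with omega = c'^* c, which is
   skew, nabla y = Q y' + y omega; the two omega-terms in B (nabla y, z) and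
   B (y, nabla z) cancel, and N also kills the derivative of Q. *)
Require Import Defs.
From HB Require Import structures.
From mathcomp Require Import all_boot all_order all_algebra.
From mathcomp Require Import ring complex.
From mathcomp Require Import all_classical all_reals all_analysis.
Import Order.TTheory GRing.Theory Num.Theory.
Import numFieldNormedType.Exports.

Set Implicit Arguments.
Unset Strict Implicit.
Unset Printing Implicit Defensive.

Local Open Scope classical_set_scope.
Local Open Scope ring_scope.

(** * Scalars and matrices *)

Section Scalars.
Variables (R : realType) (k : scalar_kind).
Local Notation F := (scalars R k).

Lemma reF_is_linear : linear_for *%R (@reF R k : F -> R).
Proof. by case: k => a /=; [|case=> ? ? []|case=> ? ? ? ? []]. Qed.
HB.instance Definition _ :=
  GRing.isLinear.Build R F R *%R (@reF R k) reF_is_linear.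

Lemma conjF_is_linear : linear (@conjF R k : F -> F).
Proof.
move=> a x y; rewrite conjFD; congr (_ + _).
by case: k x => [x|[u v]|[u v w z]] //=;
  [congr (@Complex R)|congr (@Quat R)]; rewrite /= mulrN.
Qed.
HB.instance Definition _ := GRing.isLinear.Build R F F *:%R (@conjF R k)
  conjF_is_linear.

Lemma conjFK : involutive (@conjF R k).
Proof.
by case: k => [x|[a b]|[a b c d]] //=; [congr (@Complex R)|congr (@Quat R)];
  rewrite /= opprK.
Qed.

Lemma conjF1 : conjF (1 : F) = 1.
Proof.
by case: k => //=; [congr (@Complex R)|congr (@Quat R)]; rewrite /= oppr0.
Qed.

Lemma reF1 : reF (1 : F) = 1.
Proof. by case: k. Qed.

Lemma reF_conj (x : F) : reF (conjF x) = reF x.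
Proof. by case: k x => [x|[]|[]]. Qed.

Lemma reFC (x y : F) : reF (x * y) = reF (y * x).
Proof.
case: k x y => [x y|[a b] [c d]|[a b c d] [a' b' c' d']] /=.
- exact: mulrC.
- by rewrite mulrC [b * d]mulrC.
- ring.
Qed.

Lemma reF_ge0 (x : F) : 0 <= reF (conjF x * x).
Proof.
case: k x => [x|[a b]|[a b c d]] /=; rewrite ?mulNr ?opprK -?expr2;
  by rewrite ?addr_ge0 // sqr_ge0.
Qed.

Lemma reF_eq0 (x : F) : (reF (conjF x * x) == 0) = (x == 0).
Proof.
apply/eqP/eqP => [|->]; last by rewrite mulr0 linear0.
case: k x => [x|[a b]|[a b c d]] /=; rewrite ?mulNr ?opprK -?expr2.
- by move/eqP; rewrite sqrf_eq0 => /eqP.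
- move/eqP; rewrite paddr_eq0 ?sqr_ge0 // !sqrf_eq0 => /andP[/eqP-> /eqP->].
  by [].
- move/eqP; rewrite !paddr_eq0 ?addr_ge0 ?sqr_ge0 // !sqrf_eq0.
  by move=> /andP[/andP[/andP[/eqP-> /eqP->]/eqP->]/eqP->].
Qed.

(** Each imaginary coordinate equals its own opposite. This makes the trace of a self-adjoint matrix
    a real scalar. *)
Lemma conjF_fixed (x : F) : conjF x = x -> x = (reF x)%:A.
Proof.
have h (a : R) : - a = a -> a = 0.
  by move=> /eqP; rewrite eq_sym -addr_eq0 -mulr2n mulrn_eq0 => /eqP.
case: k x => [x _|[a b]|[a b c d]] /=; first by rewrite /GRing.scale /= mulr1.
- by case=> /h ->; congr (@Complex R); rewrite /= ?mulr1 ?mulr0.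
- by case=> /h -> /h -> /h ->; congr (@Quat R); rewrite /= ?mulr1 ?mulr0.
Qed.

Lemma basisF_expand (x : F) : x = \sum_(e <- basisF R k) reF (conjF e * x) *: e.
Proof.
case: k x => [x|[a b]|[a b c d]] /=; rewrite ?big_cons big_nil.
- by rewrite addr0 mul1r /GRing.scale /= mulr1.
- by congr (@Complex R); rewrite /=; ring.
- by congr (@Quat R); rewrite /=; ring.
Qed.

Lemma basisF_norm (e : F) : e \in basisF R k -> conjF e * e = 1.
Proof.
case: k e => [x|x|x] /=; rewrite !inE.
- by move/eqP => ->; rewrite mulr1.
- by case/orP => /eqP ->; congr (@Complex R); rewrite /=; ring.
- by case/or4P => /eqP ->; congr (@Quat R); rewrite /=; ring.
Qed.

(** Matrices over [F] carry only left multiplication by [F], so a real factor a is written [a%:A];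
    being central, it passes through matrix products. *)
Lemma algC_central (a : R) (x : F) : a%:A * x = x * a%:A.
Proof. by rewrite mulr_algl mulr_algr. Qed.

End Scalars.

Section Matrices.
Variables (R : realType) (k : scalar_kind).
Local Notation F := (scalars R k).

(* Over the quaternions the trace is not invariant under cyclic permutations, but
   its real part is. *)
Definition retr n (A : 'M[F]_n) : R := reF (\tr A).

Definition selfadj n (A : 'M[F]_n) : Prop := adjmx A = A.

Lemma adjmx_is_additive p q : zmod_morphism (@adjmx R k p q).
Proof.
by move=> A B; apply/matrixP => i j; rewrite !mxE linearB.
Qed.
HB.instance Definition _ p q := GRing.isZmodMorphism.Build
  'M[F]_(p, q) 'M[F]_(q, p) (@adjmx R k p q) (@adjmx_is_additive p q).

Lemma retr_is_additive n : zmod_morphism (@retr n).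
Proof. by move=> A B; rewrite /retr !linearB. Qed.
HB.instance Definition _ n := GRing.isZmodMorphism.Build
  'M[F]_n R (@retr n) (@retr_is_additive n).

Lemma adjmxK p q (A : 'M[F]_(p, q)) : adjmx (adjmx A) = A.
Proof. by apply/matrixP => i j; rewrite !mxE conjFK. Qed.

Lemma adjmx1 n : adjmx (1%:M : 'M[F]_n) = 1%:M.
Proof.
apply/matrixP => i j; rewrite !mxE eq_sym.
by case: eqP => _ /=; rewrite ?conjF1 ?linear0.
Qed.

Lemma adjmx_algZ p q (a : R) (A : 'M[F]_(p, q)) : adjmx (a%:A *: A) = a%:A *: adjmx A.
Proof. by apply/matrixP => i j; rewrite !mxE !mulr_algl linearZ. Qed.

Lemma mulmx_algZr p q r (a : R) (A : 'M[F]_(p, q)) (B : 'M[F]_(q, r)) :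
  A *m (a%:A *: B) = a%:A *: (A *m B).
Proof.
apply/matrixP => i j; rewrite !mxE mulr_sumr; apply: eq_bigr => l _.
by rewrite !mxE mulrA -algC_central mulrA.
Qed.

Lemma scaler_algA p q (a b : R) (A : 'M[F]_(p, q)) :
  a%:A *: (b%:A *: A) = (a * b)%:A *: A.
Proof. by rewrite scalerA mulr_algl scalerA. Qed.

Lemma retr_algZ n (a : R) (A : 'M[F]_n) : retr (a%:A *: A) = a * retr A.
Proof. by rewrite /retr linearZ /= mulr_algl linearZ. Qed.

Lemma retrC p q (A : 'M[F]_(p, q)) (B : 'M[F]_(q, p)) :
  retr (A *m B) = retr (B *m A).
Proof.
rewrite /retr /mxtrace !linear_sum.
under eq_bigr do rewrite mxE linear_sum.
rewrite exchange_big /=; apply: eq_bigr => i _.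
by rewrite mxE linear_sum; apply: eq_bigr => j _; rewrite reFC.
Qed.

Lemma retr_adj n (A : 'M[F]_n) : retr (adjmx A) = retr A.
Proof.
by rewrite /retr /mxtrace !linear_sum; apply: eq_bigr => i _;
  rewrite !mxE /= reF_conj.
Qed.

Lemma retr1 n : retr (1%:M : 'M[F]_n) = n%:R.
Proof. by rewrite /retr mxtrace1 raddfMn /= reF1. Qed.

(** The real trace of A^* A is the sum of the squared norms of the entries. This definiteness
    underlies the uniqueness of normal and tangential parts. *)
Lemma retr_gram_eq0 p q (A : 'M[F]_(p, q)) : retr (adjmx A *m A) = 0 -> A = 0.
Proof.
rewrite /retr /mxtrace linear_sum /=.
under eq_bigr do rewrite mxE linear_sum /=.
move=> /eqP; rewrite psumr_eq0; last first.
  by move=> i _; apply: sumr_ge0 => j _; rewrite !mxE reF_ge0.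
move=> /allP h; apply/matrixP => i j; rewrite [RHS]mxE; apply/eqP.
have := h j (mem_index_enum _); rewrite psumr_eq0; last first.
  by move=> l _; rewrite !mxE reF_ge0.
by move=> /allP /(_ i (mem_index_enum _)) /=; rewrite !mxE reF_eq0.
Qed.

Lemma selfadj_trace n (A : 'M[F]_n) : selfadj A -> \tr A = (retr A)%:A.
Proof.
move=> hA; apply: conjF_fixed; rewrite -{2}hA /mxtrace linear_sum.
by apply: eq_bigr => i _; rewrite !mxE.
Qed.

Lemma selfadj11 (A : 'M[F]_1) : selfadj A -> A = (retr A)%:A *: 1%:M.
Proof.
move=> hA; rewrite scalemx1 -selfadj_trace //.
by rewrite /mxtrace big_ord1 {1}[A]mx11_scalar.
Qed.

Lemma herm0P n (A : 'M[F]_n) : herm0 A <-> selfadj A /\ retr A = 0.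
Proof.
split=> -[hA tA]; split=> //; first by rewrite /retr tA linear0.
by rewrite selfadj_trace // tA scale0r.
Qed.

Lemma eq_mulmx_cV p q (A B : 'M[F]_(p, q)) :
  (forall v : 'cV[F]_q, A *m v = B *m v) -> A = B.
Proof.
move=> h; apply/matrixP => i j; have := h (delta_mx j 0).
by rewrite -!colE => /matrixP/(_ i 0); rewrite !mxE.
Qed.

Lemma selfadjD n (A B : 'M[F]_n) : selfadj A -> selfadj B -> selfadj (A + B).
Proof. by move=> hA hB; rewrite /selfadj raddfD /= hA hB. Qed.

Lemma selfadjN n (A : 'M[F]_n) : selfadj A -> selfadj (- A).
Proof. by move=> hA; rewrite /selfadj raddfN /= hA. Qed.

Lemma selfadj_algZ n a (A : 'M[F]_n) : selfadj A -> selfadj (a%:A *: A).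
Proof. by move=> hA; rewrite /selfadj adjmx_algZ hA. Qed.

Lemma selfadj_conj p q (A : 'M[F]_(p, q)) (B : 'M[F]_q) :
  selfadj B -> selfadj (A *m B *m adjmx A).
Proof. by move=> hB; rewrite /selfadj !adjmxM adjmxK hB mulmxA. Qed.

End Matrices.

(** * Smooth functions and curves *)

Section SmoothFunctions.
Variable R : realType.
Implicit Types f g : R -> R.

Definition smooth f : Prop := forall (r : nat) (t : R), derivable (derive1n r f) t 1.

(** Induction on the order: derivative r + 1 of f is derivative r of [derive1 f], which again
    satisfies P. *)
Lemma smooth_coind (P : (R -> R) -> Prop) :
  (forall f, P f -> (forall t, derivable f t 1) /\ P (derive1 f)) ->
  forall f, P f -> smooth f.
Proof.
move=> hP f Pf r; elim: r f Pf => [|r IH] f /hP[df Pf] //.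
by rewrite derive1Sn; exact: IH.
Qed.

Lemma smooth_derivable f t : smooth f -> derivable f t 1.
Proof. by move/(_ 0). Qed.

Lemma smooth_derive1 f : smooth f -> smooth (derive1 f).
Proof. by move=> sf r; rewrite -derive1Sn; exact: sf. Qed.

Lemma is_derive1 f (t : R) : smooth f -> is_derive t (1 : R) f (derive1 f t).
Proof.
move=> sf; rewrite derive1E; apply: DeriveDef; last by [].
exact: smooth_derivable.
Qed.

(* The ring generated by the smooth functions is closed under derivation, which is
   the coinduction hypothesis needed for sums and products. *)
Inductive smooth_ring : (R -> R) -> Prop :=
| smooth_ring_gen f : smooth f -> smooth_ring f
| smooth_ring_add f g : smooth_ring f -> smooth_ring g -> smooth_ring (f + g)
| smooth_ring_mul f g : smooth_ring f -> smooth_ring g -> smooth_ring (f * g).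

Lemma smooth_ring_smooth f : smooth_ring f -> smooth f.
Proof.
apply: smooth_coind => {}f; elim=> {f} [f sf|f g sf [df IHf] sg [dg IHg]|
    f g sf [df IHf] sg [dg IHg]].
- by split=> [t|]; [exact: smooth_derivable|apply/smooth_ring_gen/smooth_derive1].
- split=> [t|]; first exact: derivableD.
  have -> : derive1 (f + g) = derive1 f + derive1 g.
    by apply/funext => t; rewrite derive1E deriveD // -!derive1E.
  exact: smooth_ring_add.
- split=> [t|]; first exact: derivableM.
  have -> : derive1 (f * g) = f * derive1 g + g * derive1 f.
    by apply/funext => t; rewrite derive1E deriveM // -!derive1E.
  by apply: smooth_ring_add; apply: smooth_ring_mul.
Qed.

Lemma smoothD f g : smooth f -> smooth g -> smooth (f + g).
Proof.
by move=> sf sg; apply/smooth_ring_smooth/smooth_ring_add; exact: smooth_ring_gen.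
Qed.

Lemma smoothM f g : smooth f -> smooth g -> smooth (f * g).
Proof.
by move=> sf sg; apply/smooth_ring_smooth/smooth_ring_mul; exact: smooth_ring_gen.
Qed.

Lemma is_derive_trig (a b w t : R) :
  is_derive t (1 : R) (fun t => a * cos (w * t) + b * sin (w * t))
    ((w * b) * cos (w * t) + (- (w * a)) * sin (w * t)).
Proof.
have hw : is_derive t (1 : R) (fun t => w * t) w.
  by have := is_deriveZ w (is_derive_id t (1 : R)); rewrite /GRing.scale /= mulr1.
have hc := is_derive1_comp (is_derive_cos (w * t)) hw.
have hs := is_derive1_comp (is_derive_sin (w * t)) hw.
apply: is_derive_eq (is_deriveD (is_deriveZ a hc) (is_deriveZ b hs)) _.
by rewrite /GRing.scale /=; ring.
Qed.

(** For a fixed frequency w these functions form a family closed under derivation, with (a, b) sent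
    to (w b, - w a). They parametrize great circles below. *)
Lemma smooth_trig (a b w : R) : smooth (fun t => a * cos (w * t) + b * sin (w * t)).
Proof.
apply: (@smooth_coind (fun f => exists a b,
  f = fun t => a * cos (w * t) + b * sin (w * t))); last by exists a, b.
move=> _ [{}a [{}b ->]]; split=> [t|].
  by have [] := is_derive_trig a b w t.
exists (w * b), (- (w * a)); apply/funext => t; rewrite derive1E.
by have [] := is_derive_trig a b w t.
Qed.

Lemma smooth_cst (a : R) : smooth (fun=> a).
Proof.
(* Frequency 0 makes constants a special case. *)
have -> : (fun=> a) = fun t : R => a * cos (0 * t) + 0 * sin (0 * t).
  by apply/funext => t; rewrite !mul0r cos0 mulr1 addr0.
exact: smooth_trig.
Qed.

Lemma smooth_sum (I : eqType) (s : seq I) (h : I -> R -> R) :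
  (forall i, i \in s -> smooth (h i)) -> smooth (fun t => \sum_(i <- s) h i t).
Proof.
elim: s => [|i s IH] sh.
  by under eq_fun do rewrite big_nil; exact: smooth_cst.
under eq_fun do rewrite big_cons; apply: smoothD.
  by apply: sh; rewrite mem_head.
by apply: IH => j js; apply: sh; rewrite in_cons js orbT.
Qed.

Lemma is_derive_bigsum (I : Type) (s : seq I) (h : I -> R -> R) (dh : I -> R) (t : R) :
  (forall i, is_derive t (1 : R) (h i) (dh i)) ->
  is_derive t (1 : R) (fun t => \sum_(i <- s) h i t) (\sum_(i <- s) dh i).
Proof.
move=> sh; elim: s => [|i s IH].
  by under eq_fun do rewrite big_nil; rewrite big_nil; exact: is_derive_cst.
by under eq_fun do rewrite big_cons; rewrite big_cons; exact: is_deriveD.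
Qed.
End SmoothFunctions.

(** * Differential calculus for curves of matrices over possibly noncommuting scalars *)

Section Curves.
Variables (R : realType) (k : scalar_kind).
Local Notation F := (scalars R k).

Lemma coordE (e x : F) :
  reF (e * x) = \sum_(b <- basisF R k) reF (e * b) * reF (conjF b * x).
Proof.
rewrite {1}[x]basisF_expand mulr_sumr linear_sum; apply: eq_bigr => b _.
by rewrite -scalerAr linearZ mulrC.
Qed.

(** Expanding the left factor in the real basis turns a product of possibly noncommuting scalars
    into a sum of products of real functions, to which the ordinary product rule applies. *)
Lemma coord_mulE (e x y : F) :
  reF (e * (x * y)) = \sum_(b <- basisF R k) reF (conjF b * x) * reF (e * b * y).
Proof.
rewrite {1}[x]basisF_expand mulr_suml mulr_sumr linear_sum; apply: eq_bigr => b _.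
by rewrite -scalerAl -scalerAr linearZ /= mulrA.
Qed.

(** Testing against every scalar e, not only basis elements, gives a condition stable under
    replacing e by e b, as products require. *)
Lemma smooth_curveP p q (c : R -> 'M[F]_(p, q)) :
  smooth_curve c <-> forall i j (e : F), smooth (fun t => reF (e * c t i j)).
Proof.
split=> h i j e; last by move=> _; exact: h.
under eq_fun do rewrite coordE.
apply: smooth_sum => b hb.
apply: (@smoothM _ (fun=> _)); first exact: smooth_cst.
exact: h.
Qed.

(** [derive1] has a value even for a nondifferentiable function; this relation also records
    differentiability, so that the rules can be chained. *)
Definition has_velocity p q (c : R -> 'M[F]_(p, q)) (t : R) (A : 'M[F]_(p, q)) :=
  forall i j (e : F), is_derive t (1 : R) (fun s => reF (e * c s i j)) (reF (e * A i j)).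

Lemma has_velocityE p q (c : R -> 'M[F]_(p, q)) t A :
  has_velocity c t A -> velocity c t = A.
Proof.
move=> h; apply/matrixP => i j; rewrite mxE [RHS]basisF_expand.
apply: eq_bigr => e _; congr (_ *: _); rewrite derive1E /coord_fun.
by have [] := h i j (conjF e).
Qed.

Lemma velocityP p q (c : R -> 'M[F]_(p, q)) t :
  smooth_curve c -> has_velocity c t (velocity c t).
Proof.
move=> sc i j e.
have -> : (fun s => reF (e * c s i j)) = (fun s => \sum_(b <- basisF R k)
    reF (e * b) * reF (conjF b * c s i j)) by apply/funext => s; rewrite coordE.
rewrite mxE mulr_sumr linear_sum; apply: is_derive_bigsum => b.
rewrite -scalerAr linearZ /= [X in is_derive _ _ _ X]mulrC.
apply: is_deriveZ; apply: is_derive1.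
by move: sc => /smooth_curveP; exact.
Qed.

Lemma has_velocityD p q (c d : R -> 'M[F]_(p, q)) t A B :
  has_velocity c t A -> has_velocity d t B ->
  has_velocity (fun s => c s + d s) t (A + B).
Proof.
move=> hc hd i j e; rewrite mxE mulrDr linearD.
under eq_fun do rewrite mxE mulrDr linearD.
exact: is_deriveD (hc i j e) (hd i j e).
Qed.

Lemma has_velocityM p q r (c : R -> 'M[F]_(p, q)) (d : R -> 'M[F]_(q, r)) t A B :
  has_velocity c t A -> has_velocity d t B ->
  has_velocity (fun s => c s *m d s) t (A *m d t + c t *m B).
Proof.
move=> hc hd i j e; rewrite !mxE -big_split mulr_sumr linear_sum.
under eq_fun do rewrite !mxE mulr_sumr linear_sum.
apply: is_derive_bigsum => l /=; rewrite mulrDr linearD /= !coord_mulE.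
under eq_fun do rewrite coord_mulE.
rewrite -big_split; apply: is_derive_bigsum => b /=.
apply: is_derive_eq (is_deriveM (hc i l (conjF b)) (hd l j (e * b))) _.
by rewrite /GRing.scale /= addrC; congr (_ + _); rewrite mulrC.
Qed.

Lemma has_velocity_adj p q (c : R -> 'M[F]_(p, q)) t A :
  has_velocity c t A -> has_velocity (fun s => adjmx (c s)) t (adjmx A).
Proof.
have h (e x : F) : reF (e * conjF x) = reF (conjF e * x).
  by rewrite -reF_conj conjFM conjFK reFC.
move=> hc i j e; rewrite !mxE h; under eq_fun do rewrite !mxE h.
exact: hc.
Qed.

Lemma has_velocity_cst p q (A : 'M[F]_(p, q)) t : has_velocity (fun=> A) t 0.
Proof. by move=> i j e; rewrite mxE mulr0 linear0; exact: is_derive_cst. Qed.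

Lemma has_velocityZ p q (a : R -> R) (da : R) (c : R -> 'M[F]_(p, q)) (t : R) A :
  is_derive t (1 : R) a da -> has_velocity c t A ->
  has_velocity (fun s => (a s)%:A *: c s) t (da%:A *: c t + (a t)%:A *: A).
Proof.
have h (b : R) (e x : F) : reF (e * (b%:A * x)) = b * reF (e * x).
  by rewrite mulr_algl -scalerAr linearZ.
move=> ha hc i j e; rewrite !mxE mulrDr linearD /= !h.
under eq_fun do rewrite !mxE h.
apply: is_derive_eq (is_deriveM ha (hc i j e)) _.
by rewrite /GRing.scale /= addrC; congr (_ + _); rewrite mulrC.
Qed.

Lemma has_velocityN p q (c : R -> 'M[F]_(p, q)) t A :
  has_velocity c t A -> has_velocity (fun s => - c s) t (- A).
Proof.
move=> hc i j e; rewrite mxE mulrN linearN.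
under eq_fun do rewrite mxE mulrN linearN.
exact: is_deriveN (hc i j e).
Qed.

Lemma has_velocity_algZ p q (a : R) (c : R -> 'M[F]_(p, q)) t A :
  has_velocity c t A -> has_velocity (fun s => a%:A *: c s) t (a%:A *: A).
Proof.
move=> hc; have := has_velocityZ (is_derive_cst a t (1 : R)) hc.
by rewrite scale0r scale0r add0r.
Qed.

Lemma smooth_curveD p q (c d : R -> 'M[F]_(p, q)) :
  smooth_curve c -> smooth_curve d -> smooth_curve (fun s => c s + d s).
Proof.
move=> /smooth_curveP hc /smooth_curveP hd; apply/smooth_curveP => i j e.
under eq_fun do rewrite mxE mulrDr linearD.
exact: smoothD (hc i j e) (hd i j e).
Qed.

Lemma smooth_curveM p q r (c : R -> 'M[F]_(p, q)) (d : R -> 'M[F]_(q, r)) :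
  smooth_curve c -> smooth_curve d -> smooth_curve (fun s => c s *m d s).
Proof.
move=> /smooth_curveP hc /smooth_curveP hd; apply/smooth_curveP => i j e.
under eq_fun do rewrite !mxE mulr_sumr linear_sum.
apply: smooth_sum => l _ /=; under eq_fun do rewrite coord_mulE.
by apply: smooth_sum => b _; apply: smoothM; [exact: hc|exact: hd].
Qed.

Lemma smooth_curve_adj p q (c : R -> 'M[F]_(p, q)) :
  smooth_curve c -> smooth_curve (fun s => adjmx (c s)).
Proof.
have h (e x : F) : reF (e * conjF x) = reF (conjF e * x).
  by rewrite -reF_conj conjFM conjFK reFC.
move=> /smooth_curveP hc; apply/smooth_curveP => i j e.
under eq_fun do rewrite !mxE h.
exact: hc.
Qed.

Lemma smooth_curve_cst p q (A : 'M[F]_(p, q)) : smooth_curve (fun=> A).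
Proof. by apply/smooth_curveP => i j e; exact: smooth_cst. Qed.

Lemma smooth_curveZ p q (a : R -> R) (c : R -> 'M[F]_(p, q)) :
  smooth a -> smooth_curve c -> smooth_curve (fun s => (a s)%:A *: c s).
Proof.
move=> ha /smooth_curveP hc; apply/smooth_curveP => i j e.
have -> : (fun t => reF (e * ((a t)%:A *: c t) i j)) = a * (fun t => reF (e * c t i j)).
  by apply/funext => t; rewrite mxE mulr_algl -scalerAr linearZ.
exact: smoothM ha (hc i j e).
Qed.

Lemma smooth_curve_algZ p q (a : R) (c : R -> 'M[F]_(p, q)) :
  smooth_curve c -> smooth_curve (fun s => a%:A *: c s).
Proof. by move=> hc; apply: smooth_curveZ => //; exact: smooth_cst. Qed.

Lemma smooth_curveN p q (c : R -> 'M[F]_(p, q)) :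
  smooth_curve c -> smooth_curve (fun s => - c s).
Proof.
move=> sc; have := smooth_curve_algZ (a := -1) sc.
by under eq_fun do rewrite scaleN1r scaleN1r.
Qed.

Lemma smooth_retr n (c : R -> 'M[F]_n) : smooth_curve c -> smooth (fun s => retr (c s)).
Proof.
move=> /smooth_curveP hc; rewrite /retr /mxtrace.
under eq_fun do rewrite linear_sum.
apply: smooth_sum => i _ /=; have := hc i i 1.
by under eq_fun do rewrite mul1r.
Qed.

End Curves.

(** * Compression to x^perp *)

Section SymmetricProduct.
Variables (R : realType) (k : scalar_kind) (n : nat).
Local Notation F := (scalars R k).
Implicit Types a b x u v w : 'cV[F]_n.

Lemma innerRC u v : innerR u v = innerR v u.
Proof. by rewrite -[LHS]retr_adj adjmxM adjmxK. Qed.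

Lemma innerRZr (a : R) u v : innerR u (a%:A *: v) = a * innerR u v.
Proof. by rewrite -[LHS]/(retr _) mulmx_algZr retr_algZ. Qed.

Lemma innerRZl (a : R) u v : innerR (a%:A *: u) v = a * innerR u v.
Proof. by rewrite innerRC innerRZr innerRC. Qed.

Lemma innerRDr u v w : innerR u (v + w) = innerR u v + innerR u w.
Proof. by rewrite -[LHS]/(retr _) mulmxDr raddfD. Qed.

Lemma innerRDl u v w : innerR (v + w) u = innerR v u + innerR w u.
Proof. by rewrite innerRC innerRDr !(innerRC u). Qed.

Lemma innerR_ge0 u : 0 <= innerR u u.
Proof.
rewrite /innerR /mxtrace linear_sum sumr_ge0 // => i _.
by rewrite mxE linear_sum sumr_ge0 // => j _; rewrite !mxE reF_ge0.
Qed.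

Lemma innerR_eq0 u : innerR u u = 0 -> u = 0.
Proof. exact: retr_gram_eq0. Qed.

Definition symp a b : 'M[F]_n := a *m adjmx b + b *m adjmx a.

Lemma sympC a b : symp a b = symp b a.
Proof. exact: addrC. Qed.

Lemma selfadj_symp a b : selfadj (symp a b).
Proof. by rewrite /selfadj raddfD /= !adjmxM !adjmxK addrC. Qed.

Lemma sympDl a a' b : symp (a + a') b = symp a b + symp a' b.
Proof. by rewrite /symp raddfD /= mulmxDl mulmxDr addrACA. Qed.

Lemma symp0l b : symp 0 b = 0.
Proof. by rewrite /symp raddf0 mulmx0 mul0mx addr0. Qed.

Lemma sympZl (r : R) a b : symp (r%:A *: a) b = r%:A *: symp a b.
Proof. by rewrite /symp adjmx_algZ mulmx_algZr -scalemxAl scalerDr. Qed.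

Lemma compress_symp (A : 'M[F]_n) a b :
  A *m symp a b *m adjmx A = symp (A *m a) (A *m b).
Proof. by rewrite /symp mulmxDr mulmxDl !adjmxM !mulmxA. Qed.

Lemma retr_symp a b : retr (symp a b) = 2 * innerR a b.
Proof.
rewrite raddfD /= retrC -[X in _ + X]retr_adj !adjmxM adjmxK [X in _ + X]retrC.
by rewrite mulr2n mulrDl mul1r [LHS]/(_ + _) -retr_adj adjmxM adjmxK.
Qed.

Lemma has_velocity_symp (c d : R -> 'cV[F]_n) t c' d' :
  has_velocity c t c' -> has_velocity d t d' ->
  has_velocity (fun s => symp (c s) (d s)) t (symp c' (d t) + symp (c t) d').
Proof.
move=> hc hd; have -> : symp c' (d t) + symp (c t) d' =
   (c' *m adjmx (d t) + c t *m adjmx d') + (d' *m adjmx (c t) + d t *m adjmx c').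
  by rewrite /symp addrACA [X in _ + X]addrC.
by apply: has_velocityD; apply: has_velocityM => //; exact: has_velocity_adj.
Qed.

Lemma smooth_symp (c d : R -> 'cV[F]_n) :
  smooth_curve c -> smooth_curve d -> smooth_curve (fun s => symp (c s) (d s)).
Proof.
by move=> sc sd; apply: smooth_curveD; apply: smooth_curveM => //;
  exact: smooth_curve_adj.
Qed.

Definition coproj x : 'M[F]_n := 1%:M - line_proj x.

Lemma selfadj_coproj x : selfadj (coproj x).
Proof. by rewrite /selfadj raddfB /= adjmx1 adjmxM adjmxK. Qed.

(** [unit_vec] fixes only the real part of x^* x; this 1 x 1 matrix is self-adjoint, hence real. *)
Lemma unit_vec_gram x : unit_vec x -> adjmx x *m x = 1%:M.
Proof.
move=> ux; rewrite [LHS]selfadj11; last by rewrite /selfadj adjmxM adjmxK.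
by rewrite [retr _]ux !scale1r.
Qed.

Lemma coproj_vec x : unit_vec x -> coproj x *m x = 0.
Proof.
by move=> ux; rewrite mulmxBl mul1mx /line_proj -mulmxA unit_vec_gram // mulmx1 subrr.
Qed.

Lemma vec_coproj x : unit_vec x -> adjmx x *m coproj x = 0.
Proof.
by move=> ux; rewrite -[coproj x]selfadj_coproj -adjmxM coproj_vec // raddf0.
Qed.

Lemma coproj_idem x : unit_vec x -> coproj x *m coproj x = coproj x.
Proof.
by move=> ux; rewrite {2}/coproj mulmxBr mulmx1 mulmxA coproj_vec // mul0mx subr0.
Qed.

Lemma coproj_perp x u : adjmx x *m u = 0 -> coproj x *m u = u.
Proof. by move=> xu; rewrite mulmxBl mul1mx /line_proj -mulmxA xu mulmx0 subr0. Qed.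

Lemma perp_coproj x v : unit_vec x -> adjmx x *m (coproj x *m v) = 0.
Proof. by move=> ux; rewrite mulmxA vec_coproj // mul0mx. Qed.

Lemma retr_line_proj x : unit_vec x -> retr (line_proj x) = 1.
Proof. by move=> ux; rewrite retrC. Qed.

(** Meant for z = c, a = y' and v = c': the part z (a^* z) is killed by Q, while y v^* z survives
    because v may have a component along the line of z. *)
Lemma coproj_symp_vec (z a y v : 'cV[F]_n) : unit_vec z -> adjmx z *m y = 0 ->
  coproj z *m ((symp a z + symp y v) *m z) = coproj z *m a + y *m (adjmx v *m z).
Proof.
move=> uz zy; have [Qz Qy] := (coproj_vec uz, coproj_perp zy).
have yz : adjmx y *m z = 0 by rewrite -[z in LHS]adjmxK -adjmxM zy raddf0.
have -> : (symp a z + symp y v) *m z = a + z *m (adjmx a *m z) + y *m (adjmx v *m z).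
  rewrite /symp !(mulmxDl _ _ z) -!mulmxA (unit_vec_gram uz) mulmx1 yz mulmx0.
  by rewrite addr0.
move: (coproj z) Qz Qy => Q Qz Qy.
by rewrite !mulmxDr !mulmxA Qz Qy !mul0mx addr0.
Qed.

Lemma has_velocity_coproj (c : R -> 'cV[F]_n) t c' : has_velocity c t c' ->
  has_velocity (fun s => coproj (c s)) t (- symp c' (c t)).
Proof.
move=> hc; rewrite -[- _]add0r; apply: has_velocityD.
  exact: has_velocity_cst.
apply: has_velocityN; apply: has_velocityM => //; exact: has_velocity_adj.
Qed.

Lemma smooth_coproj (c : R -> 'cV[F]_n) :
  smooth_curve c -> smooth_curve (fun s => coproj (c s)).
Proof.
move=> sc; apply: smooth_curveD; first exact: smooth_curve_cst.
apply: smooth_curveN; apply: smooth_curveM => //; exact: smooth_curve_adj.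
Qed.

End SymmetricProduct.

(** * Orthogonal projection onto the normal space *)

Section NormalComponent.
Variables (R : realType) (k : scalar_kind) (m : nat).
Hypothesis m_gt0 : (0 < m)%N.
Local Notation F := (scalars R k).
Local Notation n := m.+1.
Implicit Types x u v w : 'cV[F]_n.

(** For a unit x, compression by Q makes the result kill x; subtracting a multiple of Q, whose real
    trace is m, then removes the trace. *)
Definition normal_comp x (D : 'M[F]_n) : 'M[F]_n :=
  coproj x *m D *m coproj x -
  (retr (coproj x *m D *m coproj x) / m%:R)%:A *: coproj x.

Let m_neq0 : m%:R != 0 :> R.
Proof. by rewrite pnatr_eq0 -lt0n. Qed.

Lemma retr_coproj x : unit_vec x -> retr (coproj x) = m%:R.
Proof.
by move=> ux; rewrite raddfB /= retr1 retr_line_proj // -natr1 addrK.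
Qed.

Lemma normal_compD x D E : normal_comp x (D + E) = normal_comp x D + normal_comp x E.
Proof.
by rewrite /normal_comp (mulmxDr (coproj x) D) (mulmxDl _ _ (coproj x)) [retr _]raddfD /=
  mulrDl !scalerDl opprD addrACA.
Qed.

Lemma normal_compZ x (a : R) D : normal_comp x (a%:A *: D) = a%:A *: normal_comp x D.
Proof.
by rewrite /normal_comp (mulmx_algZr a (coproj x)) -scalemxAl retr_algZ
  [RHS]scalerBr scaler_algA mulrA.
Qed.

Lemma normal_comp_coproj x : unit_vec x -> normal_comp x (coproj x) = 0.
Proof.
by move=> ux; rewrite /normal_comp !coproj_idem // retr_coproj // divff // !scale1r subrr.
Qed.

Lemma normal_comp_symp x a b :
  normal_comp x (symp a b) = symp (coproj x *m a) (coproj x *m b) -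
    (retr (symp (coproj x *m a) (coproj x *m b)) / m%:R)%:A *: coproj x.
Proof. by rewrite /normal_comp -{2 4}(selfadj_coproj x) compress_symp. Qed.

(** [normal_comp] sees a and b only through Q a and Q b, and Q is idempotent. *)
Lemma normal_comp_symp_coproj x a b : unit_vec x ->
  normal_comp x (symp (coproj x *m a) b) = normal_comp x (symp a b).
Proof. by move=> ux; rewrite !normal_comp_symp mulmxA coproj_idem. Qed.

Lemma normal_comp_symp_vec x b : unit_vec x -> normal_comp x (symp x b) = 0.
Proof.
by move=> ux; rewrite normal_comp_symp coproj_vec // symp0l raddf0 mul0r !scale0r subr0.
Qed.

Lemma selfadj_normal_comp x D : selfadj D -> selfadj (normal_comp x D).
Proof.
move=> hD; apply: selfadjD.
  by rewrite -{2}(selfadj_coproj x); exact: selfadj_conj.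
by apply/selfadjN/selfadj_algZ/selfadj_coproj.
Qed.

Lemma retr_normal_comp x D : unit_vec x -> retr (normal_comp x D) = 0.
Proof. by move=> ux; rewrite raddfB /= retr_algZ retr_coproj // divfK // subrr. Qed.

Lemma normal_comp_vec x D : unit_vec x -> normal_comp x D *m x = 0.
Proof.
by move=> ux; rewrite [LHS]mulmxBl -scalemxAl -(mulmxA _ (coproj x) x)
  coproj_vec // mulmx0 scaler0 subr0.
Qed.

(** Since C = C Q = Q C, cyclicity gives Re tr (C D) = Re tr (C Q D Q); the remaining multiple of Q
    pairs with C to a multiple of Re tr C = 0. *)
Lemma retr_normal_comp_orth x (C D : 'M[F]_n) : unit_vec x ->
  selfadj C -> retr C = 0 -> C *m x = 0 -> retr (C *m (D - normal_comp x D)) = 0.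
Proof.
move=> ux hC tC Cx.
have CQ : C *m coproj x = C by rewrite mulmxBr mulmx1 mulmxA Cx mul0mx subr0.
have QC : coproj x *m C = C.
  by rewrite -{1}hC -{1}[coproj x]selfadj_coproj -adjmxM CQ hC.
have -> : C *m (D - normal_comp x D) = C *m D - C *m D *m coproj x +
    (retr (coproj x *m D *m coproj x) / m%:R)%:A *: C.
  by rewrite /normal_comp opprB addrA [LHS]mulmxBr [C *m (_ + _)]mulmxDr
    mulmx_algZr !mulmxA CQ addrAC.
rewrite raddfD raddfB /= retr_algZ tC mulr0 addr0 [X in _ - X]retrC mulmxA QC.
by rewrite subrr.
Qed.

End NormalComponent.

(** * The embedding of projective space *)

Section ProjectiveEmbedding.
Variables (R : realType) (k : scalar_kind) (m : nat).
Hypothesis m_gt0 : (0 < m)%N.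
Local Notation F := (scalars R k).
Local Notation n := m.+1.
Local Notation Phi := (@Phi R k m).
Implicit Types x : usphere R k m.
Implicit Types u v w : 'cV[F]_n.

Definition Phi_scale : R := Num.sqrt (n%:R / m%:R).
Local Notation s := Phi_scale.

Let m_neq0 : m%:R != 0 :> R.
Proof. by rewrite pnatr_eq0 -lt0n. Qed.

Lemma Phi_scale_gt0 : 0 < s.
Proof. by rewrite sqrtr_gt0 divr_gt0 // ltr0n. Qed.

Lemma Phi_scale_sqr : s * s = n%:R / m%:R.
Proof. by rewrite -expr2 sqr_sqrtr // divr_ge0. Qed.

Lemma unit_vec_val x : unit_vec (val x).
Proof. by case: x => x /= /asboolP. Qed.
Hint Resolve unit_vec_val : core.

Lemma tangent_innerR x u : tangent x u -> innerR (val x) u = 0.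
Proof. by move=> xu; rewrite -[LHS]/(retr _) xu raddf0. Qed.

(** * Curves with prescribed velocity and the differential of [Phi] *)

Lemma usphere_curve (c : R -> 'cV[F]_n) : (forall t, unit_vec (c t)) ->
  exists d : R -> usphere R k m, forall t, val (d t) = c t.
Proof. by move=> uc; exists (fun t => exist _ (c t) (asboolT (uc t))). Qed.

(** The witness is the great circle cos (a t) x + a^-1 sin (a t) u with a = |u|; it stays on the
    sphere since Re x^* u = 0. *)
Lemma sphere_curve_velocity x u : innerR (val x) u = 0 ->
  exists c, [/\ sphere_curve c, c 0 = x & velocity (fun t => val (c t)) 0 = u].
Proof.
move=> xu; pose a := Num.sqrt (innerR u u).
have aa : a * a = innerR u u by rewrite -expr2 sqr_sqrtr // innerR_ge0.
pose gc t := (1 * cos (a * t) + 0 * sin (a * t))%:A *: val x +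
             (0 * cos (a * t) + a^-1 * sin (a * t))%:A *: u.
(* If [a = 0] then [u = 0], and the junk value [a^-1 = 0] is harmless. *)
have ugc t : unit_vec (gc t).
  rewrite /unit_vec /gc !(innerRDr, innerRDl, innerRZr, innerRZl) (innerRC u) xu.
  rewrite [innerR (val x) _]unit_vec_val -aa.
  have [a0|a0] := eqVneq a 0; first by rewrite a0 !mul0r sin0 cos0; ring.
  by rewrite -[RHS](cos2Dsin2 (a * t)); field.
have [c cE] := usphere_curve ugc.
have valcE : (fun t => val (c t)) = gc by apply/funext => t; rewrite cE.
exists c; split.
- rewrite /sphere_curve valcE.
  by apply: smooth_curveD; apply: smooth_curveZ => //;
    try exact: smooth_trig; exact: smooth_curve_cst.
- apply: val_inj; rewrite cE /gc !mulr0 cos0 sin0.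
  by rewrite !(mulr0, mul0r) !mulr1 !addr0 !scale0r !scale1r addr0.
rewrite valcE; apply: has_velocityE.
(* u is written in the literal form that the sum and product rules produce at time 0. *)
have -> : u = ((a * 0) * cos (a * 0) + (- (a * 1)) * sin (a * 0))%:A *: val x +
    (1 * cos (a * 0) + 0 * sin (a * 0))%:A *: 0 +
    (((a * a^-1) * cos (a * 0) + (- (a * 0)) * sin (a * 0))%:A *: u +
    (0 * cos (a * 0) + a^-1 * sin (a * 0))%:A *: 0).
  rewrite !mulr0 cos0 sin0 !(mulr0, mul0r) !scaler0 !addr0 !scale0r add0r mulr1.
  have [a0|a0] := eqVneq a 0; last by rewrite divff // !scale1r.
  by rewrite [u]innerR_eq0 ?scaler0 // -aa a0 mul0r.
by apply: has_velocityD; apply: has_velocityZ; try exact: is_derive_trig;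
  exact: has_velocity_cst.
Qed.

Definition dPhi x u : 'M[F]_n := s%:A *: symp u (val x).

(** [Phi_class_of] removes the choice of representative, leaving a quadratic expression in c. The
    velocity v need not be horizontal. *)
Lemma has_velocity_Phi (c : R -> usphere R k m) t v :
  has_velocity (fun t => val (c t)) t v ->
  has_velocity (fun t => Phi (class_of (c t))) t (dPhi (c t) v).
Proof.
move=> hc; have -> : (fun t => Phi (class_of (c t))) = fun t =>
   s%:A *: (val (c t) *m adjmx (val (c t)) - (n%:R^-1 : R)%:A%:M).
  by apply/funext => r; rewrite Phi_class_of.
apply: has_velocity_algZ; rewrite -[symp _ _]addr0; apply: has_velocityD.
  by apply: has_velocityM => //; exact: has_velocity_adj.
exact: has_velocity_cst.
Qed.

Lemma smooth_curve_Phi (c : R -> usphere R k m) :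
  sphere_curve c -> smooth_curve (fun t => Phi (class_of (c t))).
Proof.
move=> hc; have -> : (fun t => Phi (class_of (c t))) = fun t =>
   s%:A *: (val (c t) *m adjmx (val (c t)) - (n%:R^-1 : R)%:A%:M).
  by apply/funext => r; rewrite Phi_class_of.
apply: smooth_curve_algZ; apply: smooth_curveD; last exact: smooth_curve_cst.
by apply: smooth_curveM => //; exact: smooth_curve_adj.
Qed.

(** A great circle shows that the defining set is inhabited, and [has_velocity_Phi] gives every
    admissible curve the same value. *)
Lemma differential_Phi x u : tangent x u -> differential Phi x u = dPhi x u.
Proof.
move=> xu; apply: xget_unique.
  have [c [sc c0 vc]] := sphere_curve_velocity (tangent_innerR xu).
  exists c; split => //; rewrite -c0 -vc; symmetry; apply: has_velocityE.
  by apply: has_velocity_Phi; exact: velocityP.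
move=> _ [c [sc <- <- ->]]; apply: has_velocityE.
by apply: has_velocity_Phi; exact: velocityP.
Qed.

(** * The normal space of the embedding *)

Lemma Phi_retr x (C : 'M[F]_n) :
  retr (Phi (class_of x) *m C) = s * (retr (line_proj (val x) *m C) - n%:R^-1 * retr C).
Proof.
rewrite Phi_class_of /Phi_unit -scalemxAl retr_algZ; congr (_ * _).
rewrite mulmxBl raddfB /=; congr (_ - _).
by rewrite mul_scalar_mx retr_algZ.
Qed.

(** The two halves of [symp u x] contribute equally because C is self-adjoint. Orthogonality to the
    tangent space thus becomes a condition on the vector C x. *)
Lemma dPhi_retr x u (C : 'M[F]_n) : selfadj C ->
  retr (dPhi x u *m C) = s * (2 * retr (adjmx u *m (C *m val x))).
Proof.
move=> hC; rewrite -scalemxAl retr_algZ /symp mulmxDl raddfD /=; congr (_ * _).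
rewrite mulr2n mulrDl mul1r; congr (_ + _); last first.
  by rewrite -mulmxA retrC mulmxA.
by rewrite -retr_adj !adjmxM adjmxK hC mulmxA retrC mulmxA.
Qed.

(** For trace-free Hermitian C, orthogonality to tangent vectors says Q C x = 0, and orthogonality
    to the position vector says x^* C x = 0; together they give C x = 0. *)
Lemma normal_spaceP x (C : 'M[F]_n) : Defs.normal_space Phi x C <->
  [/\ selfadj C, retr C = 0 & C *m val x = 0].
Proof.
have ux := unit_vec_val x; split; last first.
  move=> [hC tC Cx]; split; first by apply/herm0P.
    rewrite [LHS]Phi_retr /line_proj -mulmxA.
    by rewrite -{1}hC -adjmxM Cx raddf0 mulmx0 tC raddf0 mulr0 subrr mulr0.
  move=> u xu; rewrite differential_Phi // [LHS]dPhi_retr // Cx.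
  by rewrite mulmx0 raddf0 !mulr0.
move=> [/herm0P[hC tC] PC TC]; split => //.
(* z is itself tangent, so testing C against the image of z yields Re z^* z = 0. *)
pose z := coproj (val x) *m (C *m val x).
have z0 : z = 0.
  have xz : tangent x z by exact: perp_coproj.
  have /eqP := TC z xz; rewrite differential_Phi // [ipH _ _]dPhi_retr //.
  rewrite !mulf_eq0 (gt_eqF Phi_scale_gt0) pnatr_eq0 /= => /eqP h.
  apply: innerR_eq0; rewrite -[LHS]/(retr _) {2}/z mulmxA.
  have -> : adjmx z *m coproj (val x) = adjmx z.
    by rewrite -[coproj _]selfadj_coproj -adjmxM coproj_perp.
  exact: h.
(* Normality controls only the real part of x^* C x, but this scalar is self-adjoint, hence real. *)
have xCx : adjmx (val x) *m (C *m val x) = 0.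
  have hr : selfadj (adjmx (val x) *m (C *m val x)).
    by rewrite /selfadj !adjmxM adjmxK hC mulmxA.
  rewrite [LHS]selfadj11 // -retrC.
  move: PC; rewrite [ipH _ _]Phi_retr tC mulr0 subr0 => /eqP.
  rewrite mulf_eq0 (gt_eqF Phi_scale_gt0) /= /line_proj -mulmxA retrC -mulmxA.
  by rewrite retrC => /eqP ->; rewrite !scale0r.
have := z0; rewrite /z mulmxBl mul1mx /line_proj -mulmxA xCx mulmx0 subr0.
exact.
Qed.

(** Uniqueness in the defining set: the difference of two candidates is normal, and it is orthogonal
    to itself. *)
Lemma normal_part_Phi x (D : 'M[F]_n) : selfadj D ->
  normal_part Phi x D = normal_comp (val x) D.
Proof.
have ux := unit_vec_val x => hD.
have nD : Defs.normal_space Phi x (normal_comp (val x) D).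
  apply/normal_spaceP; split; [exact: selfadj_normal_comp|
    exact: retr_normal_comp|exact: normal_comp_vec].
have oD C : Defs.normal_space Phi x C -> ipH C (D - normal_comp (val x) D) = 0.
  by move=> /normal_spaceP[hC tC Cx]; exact: retr_normal_comp_orth.
apply: xget_unique => // B [nB oB].
set N := normal_comp _ _ in nD oD *.
have nE : Defs.normal_space Phi x (B - N).
  move: nB nD => /normal_spaceP[hB tB Bx] /normal_spaceP[hN tN Nx].
  apply/normal_spaceP; split; first by apply: selfadjD => //; exact: selfadjN.
    by rewrite raddfB /= tB tN subrr.
  by rewrite mulmxBl Bx Nx subrr.
apply/eqP; rewrite -subr_eq0; apply/eqP; apply: retr_gram_eq0.
have [-> _ _] := (normal_spaceP _ _).1 nE.
have -> : (B - N) *m (B - N) = (B - N) *m (D - N) - (B - N) *m (D - B).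
  by rewrite -mulmxBr; congr (_ *m _); rewrite [RHS]addrC (opprB D B) addrA subrK.
by rewrite raddfB /= [X in X - _]oD // [X in _ - X]oB // subrr.
Qed.

(** * Gauss formula: second fundamental form and covariant derivative *)

Lemma has_velocity_dPhi (c : R -> usphere R k m) (y : R -> 'cV[F]_n) t :
  sphere_curve c -> field_along c y ->
  ambient_derivative Phi c y t =
    s%:A *: (symp (velocity y t) (val (c t)) +
             symp (y t) (velocity (fun s => val (c s)) t)).
Proof.
move=> sc [sy ty]; apply: has_velocityE.
have -> : (fun s => differential Phi (c s) (y s)) =
    fun r => s%:A *: symp (y r) (val (c r)).
  by apply/funext => r; rewrite differential_Phi.
apply: has_velocity_algZ; apply: has_velocity_symp; first exact: velocityP.
exact: velocityP (sc : smooth_curve _).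
Qed.

Lemma selfadj_ambient (c : R -> usphere R k m) (y : R -> 'cV[F]_n) t :
  sphere_curve c -> field_along c y -> selfadj (ambient_derivative Phi c y t).
Proof.
move=> sc fy; rewrite has_velocity_dPhi //.
by apply/selfadj_algZ/selfadjD; exact: selfadj_symp.
Qed.

(** The field is the projection of the constant vector w onto the moving space c(t)^perp. *)
Lemma field_along_exists (c : R -> usphere R k m) w : sphere_curve c ->
  tangent (c 0) w -> exists y, field_along c y /\ y 0 = w.
Proof.
move=> sc tw; exists (fun t => coproj (val (c t)) *m w); split; last exact: coproj_perp.
split=> [|t]; last exact: perp_coproj.
by apply: smooth_curveM; [exact: smooth_coproj|exact: smooth_curve_cst].
Qed.

(** The term in y' has the form [symp x y'], which the normal projection kills, so the value depends
    only on v and w, not on the curve or the field. *)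
Lemma second_fundamental_form_Phi x v w : tangent x v -> tangent x w ->
  second_fundamental_form Phi x v w = s%:A *: normal_comp (val x) (symp v w).
Proof.
move=> xv xw.
have key (c : R -> usphere R k m) y : sphere_curve c -> field_along c y -> c 0 = x ->
    velocity (fun t => val (c t)) 0 = v -> y 0 = w ->
    normal_part Phi x (ambient_derivative Phi c y 0) =
    s%:A *: normal_comp (val x) (symp v w).
  move=> sc fy cx cv yw; rewrite normal_part_Phi; last exact: selfadj_ambient.
  rewrite has_velocity_dPhi // cx cv yw normal_compZ normal_compD.
  by rewrite sympC normal_comp_symp_vec // add0r sympC.
have [c [sc c0 vc]] := sphere_curve_velocity (tangent_innerR xv).
have [|y [fy y0]] := @field_along_exists c w sc; first by rewrite c0.
apply: xget_unique; first by exists c, y; split => //; rewrite key.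
by move=> _ [c' [y' [[sc' fy'] c0' vc' y0' ->]]]; exact: key.
Qed.

(** For z the asserted value, the pairing of [dPhi x u] with D - [dPhi x y] is 2 s^2 Re u^* (z - y);
    so y = z works, and u = z - y shows that it is the only choice. *)
Lemma tangential_part_Phi x (D : 'M[F]_n) : selfadj D ->
  tangential_part Phi x D = (s^-1)%:A *: (coproj (val x) *m (D *m val x)).
Proof.
have ux := unit_vec_val x => hD; set z := _ *: _.
have xz : tangent x z by rewrite /tangent /= mulmx_algZr perp_coproj // scaler0.
have hs : s != 0 by rewrite gt_eqF ?Phi_scale_gt0.
have key y u : tangent x y -> tangent x u ->
    ipH (differential Phi x u) (D - differential Phi x y) =
    s * (2 * (s * innerR u (z - y))).
  move=> xy xu; rewrite !differential_Phi // [LHS]dPhi_retr; last first.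
    by apply/selfadjD/selfadjN/selfadj_algZ/selfadj_symp.
  congr (_ * (_ * _)); rewrite -innerRZr -[RHS]/(retr _); congr (retr _).
  have uQ : adjmx u *m coproj (val x) = adjmx u.
    by rewrite -[coproj _]selfadj_coproj -adjmxM coproj_perp.
  rewrite scalerBr scaler_algA mulfV // !scale1r mulmxBl [RHS]mulmxBr.
  rewrite [adjmx u *m (coproj _ *m _)]mulmxA uQ [LHS]mulmxBr; congr (_ - _).
  rewrite -scalemxAl; congr (_ *m (_ *: _)).
  rewrite /symp mulmxDl -!mulmxA unit_vec_gram // mulmx1.
  by rewrite -[X in adjmx y *m X]adjmxK -adjmxM xy raddf0 mulmx0 addr0.
apply: xget_unique.
  split=> // u xu; rewrite key // subrr -[innerR _ _]/(retr _) mulmx0 raddf0.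
  by rewrite !mulr0.
move=> y [xy oy]; have xzy : tangent x (z - y).
  by rewrite /tangent /= mulmxBr xz xy subrr.
have /eqP := oy _ xzy; rewrite key // !mulf_eq0 (negbTE hs) pnatr_eq0 /=.
by move=> /eqP /innerR_eq0 /eqP; rewrite subr_eq0 => /eqP.
Qed.

(** The last term corrects for a lift c that is not horizontal; it vanishes when c'^* c = 0. *)
Lemma covariant_derivative_Phi (c : R -> usphere R k m) (y : R -> 'cV[F]_n) t :
  sphere_curve c -> field_along c y ->
  covariant_derivative Phi c y t =
    coproj (val (c t)) *m velocity y t +
    y t *m (adjmx (velocity (fun s => val (c s)) t) *m val (c t)).
Proof.
move=> sc fy; have ux := unit_vec_val (c t).
have hs : s != 0 by rewrite gt_eqF ?Phi_scale_gt0.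
rewrite /covariant_derivative tangential_part_Phi; last exact: selfadj_ambient.
rewrite has_velocity_dPhi // -scalemxAl mulmx_algZr scaler_algA mulVf // !scale1r.
have [_ /(_ t) ty] := fy.
exact: coproj_symp_vec.
Qed.

(* A sphere curve need not be horizontal: [c^* c'] may be nonzero. *)
Lemma sphere_velocity_skew (c : R -> usphere R k m) t : sphere_curve c ->
  let v := velocity (fun s => val (c s)) t in
  adjmx v *m val (c t) = - (adjmx (val (c t)) *m v).
Proof.
move=> sc v; apply/eqP; rewrite -addr_eq0; apply/eqP.
have hv := velocityP t sc.
(* The constant c^* c = 1 is differentiated in two ways. *)
have := has_velocityE (has_velocityM (has_velocity_adj hv) hv).
have -> : (fun s => adjmx (val (c s)) *m val (c s)) = fun=> 1%:M.
  by apply/funext => r; rewrite unit_vec_gram.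
by move=> <-; apply: has_velocityE; exact: has_velocity_cst.
Qed.

(** * Isometric embedding into the unit sphere *)

Let n_neq0 : n%:R != 0 :> R.
Proof. by rewrite pnatr_eq0. Qed.

Lemma sphereH_Phi p : sphereH (Phi p).
Proof.
have -> : p = class_of (repr p) by rewrite /class_of reprK.
set x := repr p; have ux := unit_vec_val x.
have hP : selfadj (Phi (class_of x)).
  rewrite Phi_class_of; apply/selfadj_algZ/selfadjD.
    by rewrite /selfadj adjmxM adjmxK.
  by rewrite -scalemx1; apply/selfadjN/selfadj_algZ/adjmx1.
have tP : retr (Phi (class_of x)) = 0.
  rewrite -[Phi _]mulmx1 Phi_retr mulmx1 retr_line_proj // retr1.
  by rewrite mulVf // subrr mulr0.
split; first by apply/herm0P.
rewrite [LHS]Phi_retr tP mulr0 subr0 /line_proj -mulmxA retrC -mulmxA.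
rewrite Phi_class_of -scalemxAl mulmx_algZr retr_algZ mulmxBl mulmxBr.
rewrite -[val x *m _ *m _]mulmxA unit_vec_gram // mulmx1 unit_vec_gram //.
rewrite mul_scalar_mx mulmx_algZr unit_vec_gram //.
rewrite raddfB /= retr_algZ retr1 mulr1 mulrA Phi_scale_sqr.
(* The remaining identity is (m + 1) / m (1 - 1 / (m + 1)) = 1, with n spelled as m + 1 for
   [field]. *)
have := n_neq0; rewrite -natr1 => n0; field.
by rewrite m_neq0 n0.
Qed.

(** Equal images give x x^* = y y^*, so y = x (x^* y); the scalar x^* y has norm 1 because y has. *)
Lemma Phi_injective : injective Phi.
Proof.
move=> p q; rewrite -(reprK p) -(reprK q) -!/(class_of _).
move: (repr p) (repr q) => x y; rewrite !Phi_class_of /Phi_unit.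
move=> /(congr1 ( *:%R (s^-1)%:A)); rewrite !scaler_algA mulVf; last first.
  by rewrite gt_eqF ?Phi_scale_gt0.
rewrite !scale1r => /addIr xy.
have [ux uy] := (unit_vec_val x, unit_vec_val y).
pose r := adjmx (val x) *m val y.
have rE : r = (r 0 0)%:M by rewrite -mx11_scalar.
have yE : val y = val x *m r.
  by rewrite /r mulmxA xy -mulmxA unit_vec_gram // mulmx1.
apply/eqmodP/asboolP; exists (r 0 0); rewrite -rE; split => //.
have : adjmx r *m r = 1%:M.
  by rewrite {1}/r adjmxM adjmxK -mulmxA -yE unit_vec_gram.
move=> /matrixP /(_ 0 0); rewrite !mxE big_ord1 !mxE => h.
by rewrite /unit_scalar h reF1.
Qed.

(** The factor 2 s^2 is exactly [s_m]. *)
Lemma dPhi_isometric x u v : tangent x u -> tangent x v ->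
  ipH (dPhi x u) (dPhi x v) = gPhi u v.
Proof.
move=> xu xv; rewrite [LHS]dPhi_retr; last exact/selfadj_algZ/selfadj_symp.
have vx : adjmx v *m val x = 0.
  by rewrite -[X in adjmx v *m X]adjmxK -adjmxM xv raddf0.
rewrite -scalemxAl mulmx_algZr retr_algZ /symp mulmxDl -!mulmxA.
rewrite unit_vec_gram // mulmx1 vx mulmx0 addr0 /gPhi /g0 /s_m -[retr _]/(innerR u v).
by rewrite [LHS]mulrCA !mulrA -[2 * s * s]mulrA Phi_scale_sqr mulrA.
Qed.

Lemma Phi_isometric_embedding : isometric_embedding Phi (@gPhi R k m).
Proof.
split; [exact: sphereH_Phi|exact: Phi_injective|exact: smooth_curve_Phi|].
by move=> x u v xu xv; rewrite !differential_Phi // dPhi_isometric.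
Qed.

(** * Real orthonormal bases and minimality *)

Lemma gPhi_expand x r (e : 'I_r -> 'cV[F]_n) u :
  orthonormal_basis (@gPhi R k m) x e -> tangent x u ->
  u = \sum_i (gPhi (e i) u)%:A *: e i.
Proof.
move=> [te oe he] /he[a ->]; apply: eq_bigr => i _; congr (_%:A *: _).
rewrite /gPhi /g0 -[innerR _ _]/(retr _) mulmx_sumr raddf_sum mulr_sumr (bigD1 i) //=.
rewrite big1 ?addr0 => [|j ji]; rewrite mulmx_algZr retr_algZ mulrCA
  -[_ * retr _]/(gPhi (e i) _).
  by rewrite oe eqxx mulr1.
by rewrite oe eq_sym (negbTE ji) mulr0.
Qed.

(** For u in x^perp, the coordinate of e_i^* u along a basis scalar b is the real part of e_i^* u
    b^*. Summing over i recovers u b^*, and multiplication by b gives u back, once for each b. *)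
Lemma sum_line_proj x r (e : 'I_r -> 'cV[F]_n) :
  orthonormal_basis (@gPhi R k m) x e ->
  (s_m R m)%:A *: \sum_i line_proj (e i) =
    ((size (basisF R k))%:R : R)%:A *: coproj (val x).
Proof.
move=> be; have [te _ _] := be; have ux := unit_vec_val x.
(* The sum absorbs Q on the right, so it suffices to evaluate it on vectors Q v of x^perp. *)
have TQ : (\sum_i line_proj (e i)) *m coproj (val x) = \sum_i line_proj (e i).
  rewrite mulmx_suml; apply: eq_bigr => i _; rewrite /line_proj -mulmxA.
  by rewrite -[coproj _]selfadj_coproj -adjmxM coproj_perp //; exact: te.
apply: eq_mulmx_cV => v; rewrite -TQ -!scalemxAl -mulmxA.
set u := coproj _ *m v; have xu : tangent x u by exact: perp_coproj.
have tub (b : F) : tangent x (u *m b%:M).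
  by rewrite /tangent /= mulmxA xu mul0mx.
have eiu i : (s_m R m)%:A *: (line_proj (e i) *m u) =
    \sum_(b <- basisF R k) (gPhi (e i) (u *m (conjF b)%:M))%:A *: e i *m b%:M.
  rewrite /line_proj -mulmxA -mulmx_algZr.
  have -> : (s_m R m)%:A *: (adjmx (e i) *m u) =
      \sum_(b <- basisF R k) (gPhi (e i) (u *m (conjF b)%:M))%:A *: b%:M.
    rewrite [adjmx _ *m _]mx11_scalar {1}[_ 0 0]basisF_expand.
    set p := _ *m _; rewrite raddf_sum scaler_sumr; apply: eq_bigr => b _.
    rewrite /gPhi /g0 -scaler_algA; congr (_ *: _).
    rewrite /= -[_ *: b]mulr_algl -scale_scalar_mx; congr (_%:A *: _).
    rewrite /innerR mulmxA -/p [p]mx11_scalar -scalar_mxM.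
    by rewrite /mxtrace big_ord1 !mxE mulr1n reFC.
  rewrite mulmx_sumr; apply: eq_bigr => b _.
  by rewrite mulmx_algZr scalemxAl.
rewrite mulmx_suml scaler_sumr; under eq_bigr do rewrite eiu.
(* The sum over i is taken first, for fixed b; [big_seq] retains the membership of b needed for b^*
   b = 1. *)
rewrite exchange_big /= big_seq.
under eq_bigr => b hb.
  rewrite -mulmx_suml -(gPhi_expand be (tub _)).
  rewrite -mulmxA -scalar_mxM basisF_norm // mulmx1.
  over.
rewrite -big_seq big_const_seq count_predT iter_addr_0.
by rewrite -scaler_nat [in RHS]scaler_nat.
Qed.

Lemma Phi_minimal : minimal_immersion Phi (@gPhi R k m).
Proof.
move=> x r e be; have [te _ _] := be; have ux := unit_vec_val x.
have sm0 : s_m R m != 0 by rewrite /s_m !mulf_neq0 ?invr_eq0 ?pnatr_eq0 -?lt0n.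
under eq_bigr => i _ do rewrite second_fundamental_form_Phi //.
rewrite -scaler_sumr; have -> : \sum_i normal_comp (val x) (symp (e i) (e i)) =
    normal_comp (val x) (\sum_i symp (e i) (e i)).
  symmetry; apply: (big_morph _ (normal_compD _)).
  (* N 0 = 0 follows from homogeneity with the real factor 0. *)
  by rewrite -[0](scale0r 0) -[X in X *: _](scale0r 1) normal_compZ !scale0r.
have -> : \sum_i symp (e i) (e i) = (2 : R)%:A *: \sum_i line_proj (e i).
  by rewrite scaler_sumr; apply: eq_bigr => i _; rewrite /symp mulr2n !scalerDl !scale1r.
(* Dividing by [s_m] expresses the sum of the projections as a real multiple of Q. *)
have := sum_line_proj be => /(congr1 ( *:%R ((s_m R m)^-1)%:A)).
rewrite !scaler_algA mulVf // scale1r scale1r => ->.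
by rewrite !normal_compZ normal_comp_coproj // !scaler0.
Qed.

(** * Parallelism of the second fundamental form *)

Lemma Phi_parallel : parallel_second_fundamental_form Phi.
Proof.
move=> c y z sc fy fz Byz.
have [[sy ty] [sz tz]] := (fy, fz).
have Qid t w : tangent (c t) w -> coproj (val (c t)) *m w = w by exact: coproj_perp.
(* Q fixes y and z, so up to the factor s the trace correction of B (y, z) reduces to this smooth
   coefficient. *)
pose a t := retr (symp (y t) (z t)) / m%:R.
have ByzE : Byz = fun t =>
    s%:A *: (symp (y t) (z t) - (a t)%:A *: coproj (val (c t))).
  apply/funext => t; rewrite /Byz second_fundamental_form_Phi // normal_comp_symp.
  by rewrite !Qid.
have sa : smooth a.
  by apply: smoothM; [apply: smooth_retr; exact: smooth_symp|exact: smooth_cst].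
have sQ := smooth_coproj sc.
split.
  rewrite ByzE; apply/smooth_curve_algZ/smooth_curveD; first exact: smooth_symp.
  by apply/smooth_curveN/smooth_curveZ.
move=> t; have ux := unit_vec_val (c t).
set y' := velocity y t; set z' := velocity z t; set v := velocity (fun s => val (c s)) t.
have hy : has_velocity y t y' by exact: velocityP.
have hz : has_velocity z t z' by exact: velocityP.
have hc : has_velocity (fun s => val (c s)) t v := velocityP t (sc : smooth_curve _).
have -> : velocity Byz t = s%:A *: (symp y' (z t) + symp (y t) z' -
    ((derive1 a t)%:A *: coproj (val (c t)) + (a t)%:A *: - symp v (val (c t)))).
  rewrite ByzE; apply/has_velocityE/has_velocity_algZ/has_velocityD.
    exact: has_velocity_symp.
  apply/has_velocityN/has_velocityZ; first exact: is_derive1.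
  exact: has_velocity_coproj.
rewrite normal_part_Phi; last first.
  apply/selfadj_algZ/selfadjD; first by apply/selfadjD; exact: selfadj_symp.
  apply/selfadjN/selfadjD; first exact/selfadj_algZ/selfadj_coproj.
  exact/selfadj_algZ/selfadjN/selfadj_symp.
(* The formula for B needs horizontal arguments; y (c'^* c) is horizontal because x^perp is stable
   under right multiplication by scalars. *)
have tcov (w : R -> _) : field_along c w ->
    tangent (c t) (covariant_derivative Phi c w t).
  move=> fw; rewrite covariant_derivative_Phi // /tangent /= mulmxDr perp_coproj // add0r.
  by rewrite mulmxA fw.2 mul0mx.
rewrite !second_fundamental_form_Phi //; try exact: tcov.
rewrite !covariant_derivative_Phi // -/y' -/z' -/v normal_compZ -scalerDr; congr (_ *: _).
set om := adjmx v *m val (c t).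
have om_skew : adjmx om = - om.
  by rewrite {2}/om sphere_velocity_skew // opprK /om adjmxM adjmxK.
clearbody om; rewrite -normal_compD sympDl [symp (y t) (_ + _)]sympC sympDl.
(* Skewness of [om] turns the two symmetrized products into y om z^* - z om y^* and its opposite. *)
have omE : symp (y t *m om) (z t) + symp (z t *m om) (y t) = 0.
  rewrite /symp !adjmxM om_skew !mulNmx !mulmxN !mulmxA.
  by rewrite addrA subrK subrr.
rewrite [in RHS]addrACA omE addr0.
have nN D : normal_comp (val (c t)) (- D) = - normal_comp (val (c t)) D.
  by rewrite -[- D]scaleN1r -[-1 in LHS]scaleN1r normal_compZ scaleN1r scaleN1r.
(* The derivative of a Q consists of a multiple of Q and a multiple of [symp v c]; the normal
   projection kills both. *)
have n0 : normal_comp (val (c t))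
    ((derive1 a t)%:A *: coproj (val (c t)) + (a t)%:A *: - symp v (val (c t))) = 0.
  rewrite normal_compD !normal_compZ nN normal_comp_coproj // [symp v _]sympC.
  by rewrite normal_comp_symp_vec // oppr0 !scaler0 addr0.
rewrite [LHS]normal_compD nN n0 subr0 [LHS]normal_compD [RHS]normal_compD.
(* Inside N the vectors y' and z' may be replaced by Q y' and Q z'. *)
apply: (congr2 +%R).
  exact: (esym (normal_comp_symp_coproj y' (z t) ux)).
by rewrite sympC (normal_comp_symp_coproj z' (y t) ux).
Qed.

(** * Value and length of the second fundamental form on unit vectors *)

Lemma Phi_sff_unit x (V u : 'cV[F]_n) :
  tangent x V -> tangent x u -> g0 u u = 1 ->
  V = ((Num.sqrt (s_m R m))^-1)%:A *: u ->
  second_fundamental_form Phi x V V = (Num.sqrt (m%:R / n%:R : R))%:A *: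
    (line_proj u - (m%:R^-1 : R)%:A *: (1%:M - line_proj (val x))).
Proof.
move=> xV xu uu VE; rewrite second_fundamental_form_Phi // VE.
rewrite sympZl [symp u _]sympC sympZl scaler_algA normal_compZ scaler_algA.
rewrite normal_comp_symp coproj_perp // retr_symp [innerR _ _]uu mulr1.
have -> : symp u u = (2 : R)%:A *: line_proj u.
  by rewrite /symp mulr2n !scalerDl !scale1r.
have -> : (2 / m%:R : R)%:A *: coproj (val x) =
    (2 : R)%:A *: ((m%:R^-1 : R)%:A *: coproj (val x)).
  by rewrite scaler_algA.
rewrite -scalerBr scaler_algA; congr (_%:A *: _).
rewrite -invfM -expr2 sqr_sqrtr; last by rewrite /s_m divr_ge0 // mulr_ge0.
have -> : Num.sqrt (m%:R / n%:R) = s^-1 :> R.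
  by rewrite /Phi_scale -sqrtrV ?divr_ge0 // invf_div.
have s0 : s != 0 by rewrite gt_eqF ?Phi_scale_gt0.
(* With [s_m] = 2 s^2, the coefficient 2 s / [s_m] becomes s^-1, which is sqrt (m / n). *)
have -> : s_m R m = 2 * (s * s) by rewrite Phi_scale_sqr /s_m mulrA.
by field; rewrite s0.
Qed.

(** With P = u u^*, one has P = P Q = Q P, so the square of P - Q / m has real trace 1 - 2 / m + 1 /
    m = (m - 1) / m; the scalar in front contributes m / n. *)
Lemma ipH_sff x u : tangent x u -> g0 u u = 1 ->
  let B : 'M[F]_n := (Num.sqrt (m%:R / n%:R : R))%:A *:
    (line_proj u - (m%:R^-1 : R)%:A *: coproj (val x)) in
  ipH B B = (m%:R - 1) / n%:R.
Proof.
move=> xu uu B; have ux := unit_vec_val x; have uvu : unit_vec u by [].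
have Qu : coproj (val x) *m line_proj u = line_proj u by rewrite mulmxA coproj_perp.
have uQ : line_proj u *m coproj (val x) = line_proj u.
  by rewrite -mulmxA -[coproj _]selfadj_coproj -adjmxM coproj_perp.
have PP : line_proj u *m line_proj u = line_proj u.
  by rewrite {2}/line_proj mulmxA -[line_proj u *m u]mulmxA unit_vec_gram // mulmx1.
have QQ := coproj_idem ux; have tQ := retr_coproj ux; have tP := retr_line_proj uvu.
rewrite -[LHS]/(retr _) /B -scalemxAl mulmx_algZr !retr_algZ mulrA -expr2.
rewrite sqr_sqrtr ?divr_ge0 //.
(* P and Q become letters subject only to their products and traces, so that rewriting cannot unfold
   them. *)
move: (coproj (val x)) (line_proj u) Qu uQ PP QQ tQ tP => Q P Qu uQ PP QQ tQ tP.
rewrite mulmxBl !mulmxBr !mulmx_algZr -!scalemxAl PP Qu uQ QQ.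
rewrite !raddfB /= !retr_algZ tQ tP.
by field; rewrite m_neq0 nat1r n_neq0.
Qed.
End ProjectiveEmbedding.

Theorem proposition2p1 (R : realType) (k : scalar_kind) (m : nat) (hm : (1 <= m)%N) :
  let F := scalars R k in
  let n := m.+1 in
  let Phi := @Phi R k m in
  let gPhi := @gPhi R k m in
  let B := second_fundamental_form Phi in
  [/\ isometric_embedding Phi gPhi,
      minimal_immersion Phi gPhi,
      parallel_second_fundamental_form Phi
    & forall (x : usphere R k m) (V u : 'cV[F]_n),
        tangent x V -> gPhi V V = 1 ->
        tangent x u -> g0 u u = 1 ->
        V = ((Num.sqrt (s_m R m))^-1)%:A *: u ->
        B x V V = (Num.sqrt (m%:R / n%:R : R))%:A *:
                    (line_proj u - (m%:R^-1 : R)%:A *: (1%:M - line_proj (val x)))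
        /\ ipH (B x V V) (B x V V) = (m%:R - 1) / n%:R].
Proof.
split; [exact: Phi_isometric_embedding|exact: Phi_minimal|exact: Phi_parallel|].
move=> x V u xV _ xu uu VE.
rewrite [second_fundamental_form _ _ _ _](Phi_sff_unit hm xV xu uu VE).
by split => //; exact: ipH_sff.
Qed.
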